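(* Let $G$ be a multigraph (multiple edges allowed, no loops) with maximum degree $\Delta(G)$, let $k\ge 1$ be an integer, and let the palette be $\mathcal{K}=\{1,\dots,\lfloor \tfrac32\Delta(G)+\tfrac12 k\rfloor\}$. Let $S\subseteq E(G)$ carry a proper edge-colouring with colours from $\mathcal{K}$ such that every vertex of $G$ is incident with at most $k$ edges of $S$. Then this precolouring can be extended to a proper edge-colouring of all of $G$ using only colours from $\mathcal{K}$.
   Context: A proper edge-colouring assigns colours to edges so that any two edges sharing an end-vertex (including parallel edges) receive distinct colours. Extending a precolouring means producing a proper edge-colouring of all of $G$ agreeing with the given colours on $S$. *)

(* Defs.v *)
From HB Require Import structures.
From mathcomp Require Import all_boot.

Set Implicit Arguments.
Unset Strict Implicit.
Unset Printing Implicit Defensive.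

(* Edges form a type of their own, so distinct edges may have the same
   end-vertices; two distinct end-vertices per edge excludes loops. *)
Record multigraph := Multigraph {
  vertex : finType;
  edge : finType;
  ends : edge -> {set vertex};
  card_ends : forall e : edge, #|ends e| = 2
}.

Definition incident_edges (G : multigraph) (v : vertex G) : {set edge G} :=
  [set e | v \in ends e].

Definition degree (G : multigraph) (v : vertex G) : nat :=
  #|incident_edges v|.

Definition max_degree (G : multigraph) : nat :=
  \max_(v : vertex G) degree v.

(* The colours 1, ..., floor (3/2 * Delta(G) + k/2), the bound being written
   as the floor of (3 * Delta(G) + k) / 2. *)
Definition palette (G : multigraph) (k : nat) : seq nat :=
  iota 1 ((3 * max_degree G + k) %/ 2).

(* The values of [c] outside [S] are irrelevant, so this also describes
   colourings defined on [S] only. *)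
Definition proper_edge_colouring_on (G : multigraph) (S : {set edge G})
    (K : seq nat) (c : edge G -> nat) : Prop :=
  (forall e, e \in S -> c e \in K) /\
  (forall e f v, e \in S -> f \in S -> e != f ->
     v \in ends e -> v \in ends f -> c e <> c f).

Definition proper_edge_colouring (G : multigraph) (K : seq nat)
    (c : edge G -> nat) : Prop :=
  proper_edge_colouring_on [set: edge G] K c.

Definition extends_colouring (G : multigraph) (S : {set edge G})
    (c c' : edge G -> nat) : Prop :=
  forall e, e \in S -> c' e = c e.

(* Main.v *)
Require Import Defs.
From HB Require Import structures.
From mathcomp Require Import all_boot.
From mathcomp Require Import zify.

Set Implicit Arguments.
Unset Strict Implicit.
Unset Printing Implicit Defensive.

(** Let [R] be the uncoloured part of [G]. A maximum cut [H] of [R] contains at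
    least half of the edges of [R] at every vertex, so every vertex [v] meets at
    most [(Delta + k) / 2] edges of the complement of [H]. Hence the edges of
    [R] outside [H] can be coloured greedily, and afterwards every edge [uw] of
    [H] still has at least [max (d_H u) (d_H w)] admissible colours. By a theorem
    of Borodin, Kostochka and Woodall such lists suffice for the bipartite
    multigraph [H].

    That theorem follows from Galvin's argument once the edges are ranked so that
    each edge [uw] has fewer than [max (d u) (d w)] edges ranked above it at [u]
    or below it at [w]. The ranking is built by repeatedly peeling off a matching
    that meets vertices of maximum degree, found with Hall's theorem, and ranking
    it above (or, with the two sides exchanged, below) everything else. *)

(** * Bipartite multigraphs, edge rankings and Hall's theorem *)

(** A bipartite multigraph is an edge set with maps [s] and [t] to its two sides, so parallel edges
    are allowed. *)
Definition matching (A B E : finType) (s : E -> A) (t : E -> B)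
    (X : {set E}) : Prop :=
  {in X &, injective s} /\ {in X &, injective t}.

Definition fibre (A E : finType) (s : E -> A) (F : {set E}) (a : A) : {set E} :=
  [set e in F | s e == a].

Definition ranking (A B E : finType) (s : E -> A) (t : E -> B) (F : {set E})
    (r : E -> nat) : Prop :=
  forall e f, e \in F -> f \in F -> e != f -> s e = s f \/ t e = t f ->
    r e != r f.

(** The preferences in Galvin's argument: [s]-ends prefer high ranks, [t]-ends low ranks. *)
Definition beats (A B E : finType) (s : E -> A) (t : E -> B) (r : E -> nat)
    (f e : E) : bool :=
  (s f == s e) && (r e < r f) || (t f == t e) && (r f < r e).

Definition nbr (A B E : finType) (s : E -> A) (t : E -> B) (F : {set E})
    (Q : {set A}) : {set B} :=
  t @: [set e in F | s e \in Q].

Section Bipartite.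

Variables (A B E : finType) (s : E -> A) (t : E -> B).
Implicit Types (F M X : {set E}) (P Q : {set A}) (r : E -> nat).

Lemma matchingU X1 X2 :
    matching s t X1 -> matching s t X2 ->
    {in X1 & X2, forall e f, s e != s f /\ t e != t f} ->
  matching s t (X1 :|: X2).
Proof.
move=> [s1 t1] [s2 t2] dis; split=> e f /setUP[eX|eX] /setUP[fX|fX] ef.
- exact: s1.
- by case: (dis e f eX fX); rewrite ef eqxx.
- by case: (dis f e fX eX); rewrite ef eqxx.
- exact: s2.
- exact: t1.
- by case: (dis e f eX fX) => _; rewrite ef eqxx.
- by case: (dis f e fX eX) => _; rewrite ef eqxx.
- exact: t2.
Qed.

Lemma nbrP F Q b :
  reflect (exists e, [/\ e \in F, s e \in Q & t e = b]) (b \in nbr s t F Q).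
Proof.
apply: (iffP imsetP) => [[e]|[e [eF eQ <-]]].
  by rewrite inE => /andP[eF eQ] ->; exists e.
by exists e; rewrite ?inE ?eF.
Qed.

(** Induction on [#|P|], according to whether some nonempty proper subset of [P] is tight. *)
Lemma hall_marriage F P :
    (forall Q, Q \subset P -> #|Q| <= #|nbr s t F Q|) ->
  exists X, [/\ X \subset F, matching s t X & s @: X = P].
Proof.
have [n] := ubnP #|P|; elim: n F P => // n IHn F P ltPn hall.
have [->|[a aP]] := set_0Vmem P.
  exists set0; rewrite sub0set imset0; split=> //.
  by split=> e f; rewrite inE.
have [/existsP[Q /and3P[Q0 QP tight]]|/existsPn surplus] :=
    boolP [exists Q : {set A},
      [&& Q != set0, Q \proper P & #|nbr s t F Q| <= #|Q|]].
  have ltQP := proper_card QP; have sQP := proper_sub QP.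
  have [||X1 [X1F mX1 sX1]] := IHn F Q; first by lia.
    by move=> Q' Q'Q; apply: hall (subset_trans Q'Q sQP).
  (* Avoiding the neighbours of the tight [Q] keeps the two matchings disjoint; Hall's condition
     survives since [Q] has at most [#|Q|] neighbours. *)
  pose F2 := [set e in F | t e \notin nbr s t F Q].
  have [||X2 [X2F mX2 sX2]] := IHn F2 (P :\: Q).
  - rewrite cardsD (setIidPr sQP); move: Q0; rewrite -card_gt0; lia.
  - move=> Q' Q'P; have: Q :|: Q' \subset P.
      by rewrite subUset sQP (subset_trans Q'P) ?subsetDl.
    move=> /hall; rewrite cardsU.
    have ->: Q :&: Q' = set0.
      apply/setP=> x; rewrite !inE; apply/negP=> /andP[xQ xQ'].
      by move/subsetP/(_ _ xQ'): Q'P; rewrite !inE xQ.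
    have /subset_leq_card: nbr s t F (Q :|: Q') \subset
        nbr s t F Q :|: nbr s t F2 Q'.
      apply/subsetP=> _ /nbrP[e [eF /setUP[eQ|eQ'] <-]]; rewrite inE.
        by apply/orP; left; apply/nbrP; exists e.
      have [//|nN] := boolP (t e \in nbr s t F Q).
      by apply/nbrP; exists e; rewrite inE eF.
    have := leq_card_setU (nbr s t F Q) (nbr s t F2 Q'); rewrite cards0.
    move=> /leqifP; case: ifP => _; lia.
  exists (X1 :|: X2); split.
  - rewrite subUset X1F (subset_trans X2F) //.
    by apply/subsetP=> e; rewrite inE => /andP[].
  - apply: matchingU => // e f eX fX.
    have eQ : s e \in Q by rewrite -sX1 imset_f.
    have /setDP[_ fQ] : s f \in P :\: Q by rewrite -sX2 imset_f.
    have /subsetP/(_ _ fX) := X2F; rewrite inE => /andP[_ fN]; split.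
      by apply: contraNneq fQ => <-.
    apply: contraNneq fN => <-; apply/nbrP; exists e; split=> //.
    by apply: (subsetP X1F).
  by rewrite imsetU sX1 sX2 -{1}(setIidPr sQP) setID.
(* Every nonempty proper [Q] now has a spare neighbour, so an arbitrary edge [e] at [a] can be
   matched first: it costs [Q] only [t e]. *)
have /card_gt0P[b /nbrP[e [eF]]] : 0 < #|nbr s t F [set a]|.
  by apply: leq_trans (hall [set a] _); rewrite ?cards1 ?sub1set.
rewrite inE => /eqP ea _.
pose F' := [set f in F | t f != t e].
have [||X [XF mX sX]] := IHn F' (P :\ a).
- by move: ltPn; rewrite (cardsD1 a P) aP; lia.
- move=> Q QP; have [->|Q0] := eqVneq Q set0; first by rewrite cards0.
  have prQ : Q \proper P.
    apply/properP; split; first exact: subset_trans QP (subsetDl _ _).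
    by exists a => //; apply/negP=> /(subsetP QP); rewrite !inE eqxx.
  have := surplus Q; rewrite Q0 prQ /= -ltnNge => ltQ.
  have /subset_leq_card : nbr s t F Q \subset t e |: nbr s t F' Q.
    apply/subsetP=> _ /nbrP[f [fF fQ <-]]; rewrite !inE.
    have [//|ne /=] := eqVneq (t f) (t e).
    by apply/nbrP; exists f; rewrite inE fF.
  by rewrite cardsU1; lia.
exists (e |: X); split.
- rewrite subUset sub1set eF (subset_trans XF) //.
  by apply/subsetP=> f; rewrite inE => /andP[].
- apply: matchingU => //; first by split=> f g /set1P -> /set1P ->.
  move=> _ f /set1P -> fX; have /setD1P[fa _] : s f \in P :\ a.
    by rewrite -sX imset_f.
  have /subsetP/(_ _ fX) := XF; rewrite inE => /andP[_ ft].
  by rewrite ea eq_sym fa eq_sym ft.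
by rewrite imsetU1 sX ea setD1K.
Qed.

(** * Stable matchings and Galvin's list colouring *)

(* If two edges are both favourites of their s-ends and meet at a t-end, the
   worse of the two is beaten in every stable set of the remaining edges. *)
Lemma stable_matching F r :
    ranking s t F r ->
  exists M, [/\ M \subset F, matching s t M &
    {in F :\: M, forall e, exists2 f, f \in M & beats s t r f e}].
Proof.
have [n] := ubnP #|F|; elim: n F => // n IHn F ltFn rF.
pose T := [set e in F | [forall f in F, (s f == s e) ==> (r f <= r e)]].
have TF : T \subset F by apply/subsetP=> e; rewrite inE => /andP[].
have Ttop e f : e \in T -> f \in F -> s f = s e -> r f <= r e.
  rewrite inE => /andP[_ /forall_inP h] fF /eqP.
  by move/implyP: (h f fF).
have sT : {in T &, injective s}.
  move=> e f eT fT sef; apply/eqP/negPn/negP=> ef.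
  have eF := subsetP TF _ eT; have fF := subsetP TF _ fT.
  have := rF e f eF fF ef (or_introl sef).
  by have := Ttop e f eT fF (esym sef); have := Ttop f e fT eF sef; lia.
have [/existsP[e /existsP[f /and5P[eT fT ef /eqP tef ltef]]]|no] :=
  boolP [exists e, exists f,
    [&& e \in T, f \in T, e != f, t e == t f & r e < r f]].
  have eF := subsetP TF _ eT; have fF := subsetP TF _ fT.
  have [||M [MF mM stM]] := IHn (F :\ f).
  - by move: ltFn; rewrite (cardsD1 f F) fF; lia.
  - by move=> g h /setD1P[_ gF] /setD1P[_ hF]; apply: rF.
  exists M; split=> //; first exact: subset_trans MF (subsetDl _ _).
  move=> g /setDP[gF gM]; have [gf|gf] := eqVneq g f; last first.
    by apply: stM; rewrite !inE gM gf.
  have [eM|eM] := boolP (e \in M).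
    by exists e => //; rewrite gf /beats tef eqxx ltef orbT.
  (* As [e] is top at its [s]-end, [h] wins at the [t]-end shared with [f], and so beats the worse
     [f] too. *)
  have [|h hM] := stM e; first by rewrite !inE eM ef.
  have /setD1P[_ hF] := subsetP MF _ hM.
  case/orP=> /andP[/eqP eq lt].
    by have := Ttop e h eT hF eq; lia.
  exists h => //; rewrite gf /beats eq tef eqxx /=.
  by rewrite (ltn_trans lt ltef) orbT.
(* Without such a conflict the favourites form a matching, and any other edge loses to the favourite
   at its [s]-end. *)
exists T; split=> //; first split=> //.
  move=> e f eT fT tef; apply/eqP/negPn/negP=> ef.
  have := rF e f (subsetP TF _ eT) (subsetP TF _ fT) ef (or_intror tef).
  rewrite neq_ltn => /orP[lt|lt]; case/negP: no; apply/existsP.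
    by exists e; apply/existsP; exists f; rewrite eT fT ef tef eqxx.
  by exists f; apply/existsP; exists e; rewrite eT fT eq_sym ef tef eqxx.
move=> e /setDP[eF eT].
have Pe : (e \in F) && (s e == s e) by rewrite eF eqxx.
case: (@arg_maxnP _ e (fun f => (f \in F) && (s f == s e)) r Pe).
move=> f /andP[fF /eqP sfe] fmax; have fT : f \in T.
  rewrite inE fF; apply/forall_inP=> g gF; apply/implyP=> /eqP sgf.
  by apply: fmax; rewrite gF sgf sfe eqxx.
exists f => //; rewrite /beats sfe eqxx /=.
have ef : e != f by apply: contraNneq eT => ->.
have := rF e f eF fF ef (or_introl (esym sfe)).
by have := fmax e Pe; rewrite /=; lia.
Qed.

(** A colour [x] goes to a stable matching among the edges whose lists contain [x]. Every other such
    edge loses [x] but also one edge that beats it, so the inequality survives. *)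
Lemma galvin_list_colouring F r (L : E -> seq nat) :
    ranking s t F r -> {in F, forall e, uniq (L e)} ->
    {in F, forall e, #|[set f in F | beats s t r f e]| < size (L e)} ->
  exists c : E -> nat, {in F, forall e, c e \in L e} /\
    {in F &, forall e f, e != f -> s e = s f \/ t e = t f -> c e <> c f}.
Proof.
have [n] := ubnP #|F|; elim: n F L => // n IHn F L ltFn rF uL szL.
have [->|[e0 e0F]] := set_0Vmem F.
  by exists (fun=> 0); split=> e; rewrite ?inE // => f; rewrite inE.
have [x xL] : exists x, x \in L e0.
  have := szL e0 e0F; case: (L e0) => [|x l] // _.
  by exists x; rewrite inE eqxx.
pose Fx := [set e in F | x \in L e].
have FxF : Fx \subset F by apply/subsetP=> e; rewrite inE => /andP[].
have [|M [MFx [sM tM] stM]] := @stable_matching Fx r.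
  by move=> e f /(subsetP FxF) eF /(subsetP FxF) fF; apply: rF.
have MF := subset_trans MFx FxF.
have M0 : 0 < #|M|.
  rewrite card_gt0; apply/set0Pn; have [|eM] := boolP (e0 \in M).
    by exists e0.
  by case: (stM e0) => [|f]; [rewrite !inE eM e0F | exists f].
have [||e|e|c [cL cP]] := IHn (F :\: M) (fun e => rem x (L e)).
- by rewrite cardsD (setIidPr MF); have := subset_leq_card MF; lia.
- by move=> e f /setDP[eF _] /setDP[fF _]; apply: rF.
- by case/setDP=> eF _; rewrite rem_uniq ?uL.
- case/setDP=> eF eM; have lt := szL e eF.
  have sub : [set f in F :\: M | beats s t r f e] \subset
      [set f in F | beats s t r f e].
    by apply/subsetP=> f; rewrite !inE => /andP[/andP[_ ->]].
  have [xe|xe] := boolP (x \in L e); last first.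
    by rewrite rem_id //; apply: leq_ltn_trans lt; apply: subset_leq_card.
  have [|f fM bf] := stM e; first by rewrite !inE eM eF.
  rewrite size_rem //; have: [set f in F :\: M | beats s t r f e] \proper
      [set f in F | beats s t r f e].
    apply/properP; split=> //; exists f; first by rewrite inE (subsetP MF).
    by rewrite !inE fM.
  move=> /proper_card lt2; rewrite -ltnS (ltn_predK lt).
  exact: leq_ltn_trans lt2 lt.
have cx e : e \in F :\: M -> c e <> x.
  move=> eFM; have := cL e eFM; have /setDP[eF _] := eFM.
  by rewrite mem_rem_uniq ?uL // inE => /andP[/eqP].
exists (fun e => if e \in M then x else c e); split=> [e eF|e f eF fF ef adj].
  case: ifPn => eM; first by have := subsetP MFx _ eM; rewrite inE => /andP[].
  by apply: (@mem_rem _ x); apply: cL; rewrite inE eM.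
have [eM|eM] := ifPn; have [fM|fM] := ifPn.
- by case: adj => adj; case/eqP: ef; [apply: sM | apply: tM].
- by apply/nesym/cx; rewrite inE fM.
- by apply: cx; rewrite inE eM.
- by apply: cP; rewrite ?inE ?eM ?fM.
Qed.

End Bipartite.

(** * Balanced rankings and the Borodin-Kostochka-Woodall theorem *)

Definition balanced (A B E : finType) (s : E -> A) (t : E -> B) (F : {set E})
    (r : E -> nat) : Prop :=
  ranking s t F r /\ {in F, forall e, #|[set f in F | beats s t r f e]| <
    maxn #|fibre s F (s e)| #|fibre t F (t e)|}.

(** Reversing the ranks exchanges the preferences of the two sides, so each edge keeps its
    winners. *)
Lemma balanced_swap (A B E : finType) (s : E -> A) (t : E -> B) F r :
  balanced s t F r -> exists r', balanced t s F r'.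
Proof.
case=> rF bF; pose N := \max_e r e.
have rN e : r e <= N by apply: leq_bigmax.
exists (fun e => N - r e); split=> [e f eF fF ef adj|e eF].
  have := rF e f eF fF ef (match adj with or_introl h => or_intror h
                           | or_intror h => or_introl h end).
  by have := rN e; have := rN f; lia.
rewrite maxnC (leq_trans _ (bF e eF)) // ltnS subset_leq_card //.
apply/subsetP=> f; rewrite !inE => /andP[-> /=]; rewrite /beats.
case/orP=> /andP[-> lt] /=; [apply/orP; right | apply/orP; left];
  by have := rN e; have := rN f; lia.
Qed.

Lemma card_fibre_setD (A E : finType) (s : E -> A) (F X : {set E}) e :
    X \subset F -> e \in X ->
  #|fibre s (F :\: X) (s e)| < #|fibre s F (s e)|.
Proof.
move=> XF eX; apply/proper_card/properP; split.
  by apply/subsetP=> f; rewrite !inE => /andP[/andP[_ ->]].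
by exists e; rewrite !inE eqxx ?eX ?(subsetP XF).
Qed.

(* [P] is a minimal nonempty set of [s]-ends of full degree having at most
   [#|P|] neighbours of full degree. By minimality Hall's condition holds. *)
Lemma peel_matching (A B E : finType) (s : E -> A) (t : E -> B) (F : {set E})
    (D : nat) :
    0 < D ->
    0 < #|[set a | #|fibre s F a| == D]| ->
    #|[set b | #|fibre t F b| == D]| <= #|[set a | #|fibre s F a| == D]| ->
  exists X : {set E}, [/\ X \subset F, X != set0, matching s t X,
    {in X, forall e, #|fibre s F (s e)| = D} &
    {in F, forall f, s f \in s @: X -> #|fibre t F (t f)| = D ->
       t f \in t @: X}].
Proof.
set AD := [set a | _]; set BD := [set b | _] => D0 AD0 leBA.
pose F0 := [set e in F | t e \in BD].
pose ok := fun P : {set A} =>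
  [&& P != set0, P \subset AD & #|nbr s t F0 P| <= #|P|].
have okAD : ok AD.
  rewrite /ok subxx -card_gt0 AD0 (leq_trans _ leBA) // subset_leq_card //.
  by apply/subsetP=> _ /nbrP[e [+ _ <-]]; rewrite inE => /andP[].
have [P /minsetP[/and3P[P0 PAD leP] minP] _] := minset_exists okAD.
have FD a : a \in AD -> #|fibre s F a| = D by rewrite inE => /eqP.
have [cardP|neP] := eqVneq #|nbr s t F0 P| #|P|.
  have [Q QP|X [XF mX sX]] := @hall_marriage _ _ _ s t F0 P.
    have [->|Q0] := eqVneq Q set0; first by rewrite cards0.
    (* A violator of Hall's condition satisfies [ok], so by minimality it is [P], which has exactly
       [#|P|] neighbours. *)
    rewrite leqNgt; apply/negP=> lt; have QeP : Q = P.
      by apply: minP; rewrite // /ok Q0 (subset_trans QP PAD) ltnW.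
    by rewrite QeP cardP ltnn in lt.
  have XF' : X \subset F.
    by apply: subset_trans XF _; apply/subsetP=> e; rewrite inE => /andP[].
  exists X; split=> //.
  - by apply: contraNneq P0 => X0; rewrite -sX X0 imset0.
  - by move=> e eX; apply/FD/(subsetP PAD); rewrite -sX imset_f.
  move=> f fF; rewrite sX => sfP tfD.
  have tX : t @: X = nbr s t F0 P.
    apply/eqP; rewrite eqEcard cardP card_in_imset; last by case: mX.
    rewrite -sX card_in_imset ?leqnn ?andbT; last by case: mX.
    apply/subsetP=> _ /imsetP[e eX ->]; apply/nbrP; exists e.
    by rewrite (subsetP XF) ?imset_f.
  by rewrite tX; apply/nbrP; exists f; rewrite !inE fF tfD eqxx.
(* With fewer than [#|P|] neighbours, [P :\ a] would be a smaller candidate unless empty. So [P] is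
   [[set a]], [a] has no neighbour of full degree, and any single edge at [a] serves. *)
have [a aP] := set0Pn _ P0; have aAD := subsetP PAD _ aP.
have nbrS (Q : {set A}) : Q \subset P -> nbr s t F0 Q \subset nbr s t F0 P.
  move=> QP; apply/subsetP=> _ /nbrP[e [eF eQ <-]]; apply/nbrP; exists e.
  by rewrite (subsetP QP).
have Pa : P = [set a].
  apply/eqP; rewrite eqEsubset sub1set aP andbT -setD_eq0; apply/negPn/negP.
  move=> Pa0; have Pa : P :\ a = P.
    apply: minP; rewrite ?subsetDl // /ok Pa0 (subset_trans (subsetDl _ _) PAD).
    have := subset_leq_card (nbrS _ (subsetDl P [set a])).
    by move: leP neP; rewrite [#|P|](cardsD1 a) aP; lia.
  by move: aP; rewrite -Pa !inE eqxx.
have nbr0 : nbr s t F0 P = set0.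
  by apply/eqP; rewrite -cards_eq0; move: leP neP; rewrite Pa cards1; lia.
have /card_gt0P[e] : 0 < #|fibre s F a| by rewrite FD.
rewrite inE => /andP[eF /eqP sea]; exists [set e]; split.
- by rewrite sub1set.
- by apply/set0Pn; exists e; rewrite inE.
- by split=> f g /set1P -> /set1P ->.
- by move=> _ /set1P ->; rewrite sea FD.
move=> f fF; rewrite imset_set1 inE sea => /eqP sfa tfD.
have: t f \in nbr s t F0 P.
  by apply/nbrP; exists f; rewrite !inE fF tfD eqxx Pa sfa inE eqxx.
by rewrite nbr0 inE.
Qed.

(* Ranking the peeled matching [X] above everything else costs one extra
   winner only at edges whose larger end-degree drops when [X] is removed. *)
Lemma balanced_peel (A B E : finType) (s : E -> A) (t : E -> B)
    (F X : {set E}) (D : nat) r :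
    X \subset F -> matching s t X ->
    (forall b, #|fibre t F b| <= D) ->
    {in X, forall e, #|fibre s F (s e)| = D} ->
    {in F, forall f, s f \in s @: X -> #|fibre t F (t f)| = D ->
       t f \in t @: X} ->
    balanced s t (F :\: X) r ->
  exists r', balanced s t F r'.
Proof.
move=> XF [sX tX] tD sD cov [rF bF].
have rN e : r e < (\max_e r e).+1 by rewrite ltnS; apply: leq_bigmax.
set N := (\max_e r e).+1 in rN; clearbody N.
exists (fun e => if e \in X then N else r e); split.
  move=> e f eF fF ef adj; have [eX|eX] := ifPn; have [fX|fX] := ifPn.
  - by case: adj => adj; case/eqP: ef; [apply: sX | apply: tX].
  - by have := rN f; lia.
  - by have := rN e; lia.
  - by apply: rF; rewrite ?inE ?eX ?fX.
have fibD (C : finType) (u : E -> C) c :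
    #|fibre u (F :\: X) c| <= #|fibre u F c|.
  apply/subset_leq_card/subsetP=> f.
  by rewrite !inE => /andP[/andP[_ ->]].
move=> e eF; set W := [set f in F | _].
have [eX|eX] := boolP (e \in X).
  (* Nothing outranks an edge of [X], so all winners against [e] share its [t]-end, and [e] is not
     among them. *)
  rewrite leq_max; apply/orP; right; apply/proper_card/properP; split.
    apply/subsetP=> f; rewrite !inE /beats eX => /andP[-> /=].
    case/orP=> /andP[// _]; case: ifP => _; last by have := rN f; lia.
    by rewrite ltnn.
  exists e; first by rewrite inE eF eqxx.
  by rewrite inE /beats !ltnn !andbF.
have eFX : e \in F :\: X by rewrite inE eX.
have := bF e eFX; set W' := [set f in _ | _] => ltW.
have WE f : f \in W -> f \notin X -> f \in W'.
  by rewrite !inE /beats (negbTE eX) => + fX; rewrite (negbTE fX).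
have WX f : f \in W -> f \in X -> s f = s e.
  rewrite !inE /beats (negbTE eX) => + fX; rewrite fX.
  case/andP=> _ /orP[/andP[/eqP]//|/andP[_]]; by have := rN e; lia.
have [/imsetP[x xX sex]|ne] := boolP (s e \in s @: X); last first.
  have /subset_leq_card : W \subset W'.
    apply/subsetP=> f fW; apply: WE => //; apply: contra ne => fX.
    by rewrite -(WX f fW fX) imset_f.
  by have := fibD _ s (s e); have := fibD _ t (t e); lia.
have /subset_leq_card : W \subset x |: W'.
  apply/subsetP=> f fW; rewrite inE; have [fX|fX] := boolP (f \in X).
    by rewrite (sX f x) ?inE ?eqxx // (WX f fW fX).
  by rewrite (WE f) ?orbT.
have lt1 := card_fibre_setD s XF xX; rewrite (sD x xX) -sex in lt1.
have sDe : #|fibre s F (s e)| = D by rewrite sex sD.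
(* Both end-degrees of [e] in [F :\: X] are below [D], the degree of [s e] in [F]; this makes room
   for the one new winner [x]. *)
have lt2 : #|fibre t (F :\: X) (t e)| < D.
  have [tDe|] := eqVneq #|fibre t F (t e)| D; last first.
    by have := fibD _ t (t e); have := tD (t e); lia.
  have /imsetP[y yX tey] : t e \in t @: X.
    by apply: cov; rewrite // sex imset_f.
  by rewrite -tDe tey; apply: card_fibre_setD.
by rewrite cardsU1 sDe; lia.
Qed.

(** Induction on [#|F|]; by [balanced_swap], the side with at least as many vertices of maximum
    degree may be taken as the [s]-side. *)
Lemma balanced_exists (A B E : finType) (s : E -> A) (t : E -> B)
    (F : {set E}) :
  exists r, balanced s t F r.
Proof.
have [n] := ubnP #|F|; elim: n A B s t F => // n IHn A B s t F ltFn.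
have [->|[e0 e0F]] := set_0Vmem F.
  by exists (fun=> 0); split=> [e f|e]; rewrite inE.
pose D := maxn (\max_a #|fibre s F a|) (\max_b #|fibre t F b|).
have sD a : #|fibre s F a| <= D by rewrite leq_max leq_bigmax.
have tD b : #|fibre t F b| <= D by rewrite leq_max leq_bigmax ?orbT.
have D0 : 0 < D.
  apply: leq_trans (sD (s e0)); apply/card_gt0P; exists e0.
  by rewrite inE e0F eqxx.
have nonempty :
    0 < #|[set a | #|fibre s F a| == D]| + #|[set b | #|fibre t F b| == D]|.
  rewrite addn_gt0; apply/orP; rewrite !card_gt0.
  have [lea|ltb] := leqP (\max_b #|fibre t F b|) (\max_a #|fibre s F a|).
    left; apply/set0Pn; have [|a aD] := eq_bigmax (fun a => #|fibre s F a|).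
      by apply/card_gt0P; exists (s e0).
    by exists a; rewrite inE -aD /D (maxn_idPl lea).
  right; apply/set0Pn; have [|b bD] := eq_bigmax (fun b => #|fibre t F b|).
    by apply/card_gt0P; exists (t e0).
  by exists b; rewrite inE -bD /D (maxn_idPr (ltnW ltb)).
clearbody D.
wlog leBA : A B s t sD tD nonempty / #|[set b | #|fibre t F b| == D]| <=
    #|[set a | #|fibre s F a| == D]|.
  move=> gen.
  have [/gen|/ltnW/gen] := leqP #|[set b | #|fibre t F b| == D]|
    #|[set a | #|fibre s F a| == D]|; first exact.
  by rewrite addnC => /(_ tD sD nonempty)[r /balanced_swap].
have AD0 : 0 < #|[set a | #|fibre s F a| == D]| by lia.
have [X [XF X0 mX sX cov]] := peel_matching D0 AD0 leBA.
have [|r br] := IHn _ _ s t (F :\: X).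
  rewrite cardsD (setIidPr XF); move: X0; rewrite -card_gt0.
  by have := subset_leq_card XF; lia.
exact: balanced_peel mX tD sX cov br.
Qed.

Lemma bipartite_list_colouring (A B E : finType) (s : E -> A) (t : E -> B)
    (F : {set E}) (L : E -> seq nat) :
    {in F, forall e, uniq (L e)} ->
    {in F, forall e,
      maxn #|fibre s F (s e)| #|fibre t F (t e)| <= size (L e)} ->
  exists c : E -> nat, {in F, forall e, c e \in L e} /\
    {in F &, forall e f, e != f -> s e = s f \/ t e = t f -> c e <> c f}.
Proof.
move=> uL szL; have [r [rF bF]] := balanced_exists s t F.
apply: (galvin_list_colouring rF uL) => e eF.
exact: leq_trans (bF e eF) (szL e eF).
Qed.

(** * Greedy extension of colourings in a multigraph *)

Lemma size_filter_notin (T : eqType) (K l : seq T) :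
  uniq K -> size K <= size [seq x <- K | x \notin l] + size l.
Proof.
move=> uK; rewrite -(count_predC (mem l) K) addnC !size_filter leq_add2l.
rewrite -size_filter; apply: uniq_leq_size; first exact: filter_uniq.
by move=> x; rewrite mem_filter => /andP[].
Qed.

Section Multigraph.

Variable G : multigraph.
Implicit Types (D F H R S : {set edge G}) (U : {set vertex G}).
Implicit Types (K : seq nat) (c : edge G -> nat) (e f : edge G).
Implicit Types (u v w : vertex G).

Definition adjacent_edges (e : edge G) : {set edge G} :=
  [set f | ends f :&: ends e != set0].

Lemma adjacent_edgesI e f v :
  v \in ends e -> v \in ends f -> f \in adjacent_edges e.
Proof.
by move=> ve vf; rewrite inE; apply/set0Pn; exists v; rewrite inE vf.
Qed.

Lemma ends_incident e u w :
  ends e = [set u; w] -> e \in incident_edges u /\ e \in incident_edges w.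
Proof. by move=> euw; rewrite !inE euw !inE !eqxx orbT. Qed.

Definition free_colours K D c e : seq nat :=
  [seq x <- K | x \notin [seq c f | f in D :&: adjacent_edges e]].

Lemma free_colours_neq K D c e f v x :
    x \in free_colours K D c e -> f \in D -> v \in ends e -> v \in ends f ->
  x <> c f.
Proof.
rewrite mem_filter => /andP[xN _] fD ve vf xf; case/negP: xN; rewrite xf.
by apply: image_f; rewrite inE fD (adjacent_edgesI ve vf).
Qed.

Lemma card_adjacent_edges D e u w :
    ends e = [set u; w] ->
  #|D :&: adjacent_edges e| <=
    #|D :&: incident_edges u| + #|D :&: incident_edges w|.
Proof.
move=> euw; apply: leq_trans (leq_card_setU _ _); apply: subset_leq_card.
apply/subsetP=> f; rewrite !inE => /andP[-> /= /set0Pn[v]].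
by rewrite euw !inE => /andP[vf /orP[]/eqP <-]; rewrite vf ?orbT.
Qed.

Lemma size_free_colours K D c e u w :
    uniq K -> ends e = [set u; w] ->
  size K <= size (free_colours K D c e) +
    (#|D :&: incident_edges u| + #|D :&: incident_edges w|).
Proof.
move=> uK euw; set l := [seq c f | f in D :&: adjacent_edges e].
apply: leq_trans (size_filter_notin l uK) _.
by rewrite leq_add2l size_image card_adjacent_edges.
Qed.

(** Edges are coloured one at a time. The hypothesis counts [e] itself at both ends, so fewer than
    [size K] coloured edges meet it. *)
Lemma greedy_extension K S F c :
    uniq K -> proper_edge_colouring_on S K c ->
    (forall e u w, e \in F -> ends e = [set u; w] ->
       #|(S :|: F) :&: incident_edges u| + #|(S :|: F) :&: incident_edges w|
         <= size K) ->
  exists c', proper_edge_colouring_on (S :|: F) K c' /\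
    extends_colouring S c c'.
Proof.
move=> uK pS; have [n] := ubnP #|F|; elim: n F => // n IHn F ltFn szF.
have [->|[e eF]] := set_0Vmem F; first by exists c; rewrite setU0.
have SFE : S :|: F = e |: (S :|: F :\ e).
  by rewrite setUCA setD1K.
have [||c1 [[c1K c1P] c1S]] := IHn (F :\ e).
- by move: ltFn; rewrite (cardsD1 e F) eF; lia.
- move=> f u w /setD1P[_ fF] fuw; apply: leq_trans (szF f u w fF fuw).
  by apply: leq_add; apply/subset_leq_card/setSI/setUS/subsetDl.
(* [F] may overlap [S]; then [e] is coloured already. *)
have [eD|eD] := boolP (e \in S :|: F :\ e).
  by exists c1; rewrite SFE (setUidPr _) ?sub1set.
have SD : S \subset S :|: F :\ e by apply: subsetUl.
set D := S :|: F :\ e in SFE c1K c1P eD SD; clearbody D.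
have /eqP/cards2P[u [w [_ euw]]] := card_ends e.
have [eu ew] := ends_incident euw.
have [x xfree] : exists x, x \in free_colours K D c1 e.
  have := size_free_colours D c1 uK euw; have := szF e u w eF euw.
  rewrite SFE !setIUl !cardsU.
  have in1 v : e \in incident_edges v -> [set e] :&: incident_edges v = [set e].
    by move=> ev; apply/setIidPl; rewrite sub1set.
  have in0 v : [set e] :&: (D :&: incident_edges v) = set0.
    by apply/eqP; rewrite setI_eq0 disjoints1 inE (negbTE eD).
  rewrite !in1 // !in0 !cards1 cards0.
  case: free_colours => [|x l] /=; last by exists x; rewrite inE eqxx.
  by lia.
have xK : x \in K by move: xfree; rewrite mem_filter => /andP[].
pose c' f := if f == e then x else c1 f.
have c'D f : f \in D -> c' f = c1 f.
  by move=> fD; rewrite /c'; case: eqP fD => // ->; rewrite (negbTE eD).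
have c'e : c' e = x by rewrite /c' eqxx.
exists c'; split; last first.
  by move=> f fS; rewrite -c1S // c'D // (subsetP SD).
rewrite SFE; split=> [f /setU1P[->|fD]|f g v].
- by rewrite c'e.
- by rewrite c'D ?c1K.
case/setU1P=> [->|fD] /setU1P[->|gD] fg vf vg.
- by rewrite eqxx in fg.
- by rewrite c'e c'D //; apply: free_colours_neq xfree gD vf vg.
- rewrite c'e c'D //; apply/nesym.
  exact: free_colours_neq xfree fD vg vf.
- by rewrite !c'D //; apply: c1P fg vf vg.
Qed.

(** * Cuts and the extension over a bipartite part *)

Definition cut U : {set edge G} :=
  [set e | ~~ (ends e \subset U) && ~~ (ends e \subset ~: U)].

Lemma in_cut U e u w :
  ends e = [set u; w] -> (e \in cut U) = (u \in U) (+) (w \in U).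
Proof.
by move=> euw; rewrite inE euw !subUset !sub1set !inE; do 2!case: (_ \in U).
Qed.

Lemma cut_ends U e :
    e \in cut U ->
  exists u w, [/\ ends e = [set u; w], ends e :&: U = [set u] &
    ends e :\: U = [set w]].
Proof.
have /eqP/cards2P[u [w [uw euw]]] := card_ends e.
rewrite (in_cut U euw).
wlog uU : u w uw euw / u \in U.
  move=> gen; have [uU|uU] := boolP (u \in U).
    by move=> h; apply: (gen u w); rewrite ?uU.
  move=> wU; apply: (gen w u); rewrite ?(negbTE uU) //= ?addbF //.
  - by rewrite eq_sym.
  - by rewrite setUC.
rewrite uU /= => wU; exists u, w; split=> //; rewrite euw.
  rewrite setIUl (setIidPl _) ?sub1set // (_ : [set w] :&: U = set0) ?setU0 //.
  by apply/eqP; rewrite setI_eq0 disjoints1.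
rewrite setDUl (_ : [set u] :\: U = set0) ?set0U.
  by apply/setDidPl; rewrite disjoints1.
by apply/eqP; rewrite setD_eq0 sub1set.
Qed.

(* In a maximum cut, moving [v] to the other side gains nothing. *)
Lemma max_cut R :
  exists U, forall v,
    2 * #|(R :\: cut U) :&: incident_edges v| <= #|R :&: incident_edges v|.
Proof.
case: (@arg_maxnP _ set0 xpredT (fun U => #|R :&: cut U|) isT) => U _ maxU.
exists U => v; pose U' := [set x | (x \in U) (+) (x == v)].
have flip e : (e \in cut U') = (e \in cut U) (+) (v \in ends e).
  have /eqP/cards2P[u [w [uw euw]]] := card_ends e.
  rewrite !(in_cut _ euw) euw !inE ![v == _]eq_sym addbACA; congr (_ (+) _).
  by case: (eqVneq u v) uw => [->|_ _] //; rewrite eq_sym => /negbTE ->.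
have := maxU U' isT; set I := incident_edges v => leU.
have := cardsID I (R :&: cut U'); have := cardsID I (R :&: cut U).
have := cardsID (cut U) (R :&: I).
(* Away from [v] the two cuts agree and at [v] they are complementary in [R], so maximality compares
   the two parts of [R] at [v]. *)
have -> : R :&: cut U' :&: I = (R :\: cut U) :&: I.
  apply/setP=> e; rewrite ![e \in _ :&: I]inE ![e \in R :&: _]inE flip.
  rewrite [e \in _ :\: _]inE [e \in I]inE.
  by case: (v \in _); rewrite ?andbF // addbT andbT andbT andbC.
have -> : R :&: cut U' :\: I = R :&: cut U :\: I.
  apply/setP=> e; rewrite ![e \in _ :\: _]inE ![e \in R :&: _]inE flip inE.
  by case: (v \in _); rewrite ?addbF.
have -> : R :&: I :&: cut U = R :&: cut U :&: I by rewrite setIAC.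
have -> : R :&: I :\: cut U = (R :\: cut U) :&: I by rewrite setIDAC.
by move: leU => /=; lia.
Qed.

Lemma degree_le_max_degree v : degree v <= max_degree G.
Proof. exact: leq_bigmax. Qed.

(** The hypothesis leaves an edge [uw] of [H] as many free colours as [H] has edges at [u]; by
    symmetry in [u] and [w] the lists reach the larger end-degree. *)
Lemma cut_extension K U H c :
    uniq K -> H \subset cut U ->
    proper_edge_colouring_on (~: H) K c ->
    (forall e u w, e \in H -> ends e = [set u; w] ->
       #|H :&: incident_edges u| + (#|~: H :&: incident_edges u| +
         #|~: H :&: incident_edges w|) <= size K) ->
  exists c', proper_edge_colouring K c' /\ extends_colouring (~: H) c c'.
Proof.
move=> uK Hcut [cK cP] szH.
(* Vertex sets stand in for the ends: on a cut edge both are singletons, so no default vertex is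
   needed. *)
pose s e := ends e :&: U; pose t e := ends e :\: U.
have fibH (r : edge G -> {set vertex G}) e u :
    (forall f, r f \subset ends f) -> r e = [set u] ->
    fibre r H (r e) \subset H :&: incident_edges u.
  move=> rsub re; apply/subsetP=> f; rewrite !inE => /andP[-> /eqP rf] /=.
  by apply: (subsetP (rsub f)); rewrite rf re set11.
have [e eH|e eH|c2 [c2L c2P]] :=
    @bipartite_list_colouring _ _ _ s t H (free_colours K (~: H) c).
- exact: filter_uniq.
- have [u [w [euw se te]]] := cut_ends (subsetP Hcut _ eH).
  have := szH e u w eH euw; rewrite [[set u; w]]setUC in euw.
  have := szH e w u eH euw; have := size_free_colours (~: H) c uK euw.
  have /subset_leq_card := fibH s e u (fun f => subsetIl _ _) se.
  have /subset_leq_card := fibH t e w (fun f => subsetDl _ _) te.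
  rewrite geq_max.
  by move=> *; apply/andP; split; lia.
pose c' e := if e \in H then c2 e else c e.
exists c'; split; last first.
  by move=> e; rewrite inE /c' => /negbTE ->.
split=> [e _|e f v _ _ ef ve vf]; rewrite /c'.
  have [eH|eH] := ifPn; last by apply: cK; rewrite inE.
  by have := c2L e eH; rewrite mem_filter => /andP[].
have [eH|eH] := ifPn; have [fH|fH] := ifPn.
- apply: c2P => //.
  have [u [w [euw se te]]] := cut_ends (subsetP Hcut _ eH).
  have [u' [w' [fuw sf tf]]] := cut_ends (subsetP Hcut _ fH).
  have [vU|vU] := boolP (v \in U); [left|right].
    have: v \in ends e :&: U by rewrite inE ve.
    have: v \in ends f :&: U by rewrite inE vf.
    by rewrite /s se sf !inE => /eqP -> /eqP ->.
  have: v \in ends e :\: U by rewrite inE vU.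
  have: v \in ends f :\: U by rewrite inE vU.
  by rewrite /t te tf !inE => /eqP -> /eqP ->.
- by apply: free_colours_neq (c2L e eH) _ ve vf; rewrite inE.
- by apply/nesym; apply: free_colours_neq (c2L f fH) _ vf ve; rewrite inE.
- by apply: cP ef ve vf; rewrite inE.
Qed.

End Multigraph.

(** * Counting colours for the two extensions *)

Theorem theorem2p2 (G : multigraph) (k : nat) (hk : 1 <= k)
    (S : {set edge G}) (c : edge G -> nat)
    (hc : proper_edge_colouring_on S (palette G k) c)
    (hS : forall v : vertex G, #|S :&: incident_edges v| <= k) :
  exists c' : edge G -> nat,
    proper_edge_colouring (palette G k) c' /\ extends_colouring S c c'.
Proof.
have uK : uniq (palette G k) by apply: iota_uniq.
have szK : size (palette G k) = (3 * max_degree G + k) %/ 2.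
  by rewrite size_iota.
have [U cutU] := max_cut (~: S).
pose H := ~: S :&: cut U; pose F := ~: S :\: cut U.
have SFE : S :|: F = ~: H.
  by apply/setP=> e; rewrite !inE; case: (e \in S); rewrite ?andbT.
have HE v : #|H :&: incident_edges v| + #|~: H :&: incident_edges v| = degree v.
  rewrite /degree -(cardsID H (incident_edges v)) setDE.
  by rewrite ![_ :&: incident_edges v]setIC.
(* [F] has at most half of the uncoloured edges at [v], so twice the count for [S :|: F] is at most
   [degree v] plus the number of edges of [S] at [v]. *)
have half v : 2 * #|~: H :&: incident_edges v| <= max_degree G + k.
  have := cardsID S (incident_edges v); have := degree_le_max_degree v.
  have := hS v; have := cutU v; rewrite -/F setDE /degree.
  have := leq_card_setU (S :&: incident_edges v) (F :&: incident_edges v).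
  rewrite -setIUl SFE ![incident_edges v :&: _]setIC => -[+ _].
  by lia.
have le_deg u : #|H :&: incident_edges u| + #|~: H :&: incident_edges u| <=
    max_degree G by rewrite HE degree_le_max_degree.
(* Here and in the next extension the edges counted at [u] number at most Delta and those at [w] at
   most (Delta + k) / 2, which fits the palette. *)
have [e u w _ _|c1 [c1P c1S]] := greedy_extension uK hc (F := F).
  rewrite SFE szK leq_divRL //.
  by have := half w; have := le_deg u; lia.
rewrite SFE in c1P.
have [e u w _ _|c' [c'P c'S]] :=
    cut_extension uK (subsetIr _ _ : H \subset cut U) c1P.
  rewrite szK leq_divRL //.
  by have := half w; have := le_deg u; lia.
exists c'; split=> // e eS; rewrite c'S ?c1S //.
by rewrite -SFE inE eS.
Qed.
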